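(* Let $R$ be a ring and let $a \in R$ be a regular element such that the right $R$-module $K := \mathrm{r}_R(a) = \{x \in R : ax = 0\}$ has the exchange property. Then for every positive integer $n$ there exist right ideals $X_n, Y_n, E_n$ of $R$ giving (internal) direct sum decompositions $$R_R = K \oplus X_n \oplus Y_n = E_n \oplus X_n \oplus aY_n,$$ where $Y_n \subseteq a^nR$ and $E_n \cong R/aR$ as right $R$-modules. If $a^n = 0$ for some positive integer $n$, then for this $n$ one has $aY_n = Y_n = 0$, so $K \cong E_n \cong R/aR$ as right $R$-modules, and $a$ is unit-regular.
   Context: Rings are associative with identity, not necessarily commutative; $R_R$ denotes $R$ as a right module over itself. An element $a \in R$ is regular (in the sense of von Neumann) if $a = axa$ for some $x \in R$, and unit-regular if $a = aua$ for some unit $u \in R$. For a right ideal $Y$, $aY = \{ay : y \in Y\}$. A right $R$-module $M$ has the exchange property if for every right $R$-module $A$ and all decompositions $A = M' \oplus N = \bigoplus_{i \in I} A_i$ with $M' \cong M$ and $I$ an arbitrary index set, there exist submodules $A_i' \subseteq A_i$ such that $A = M' \oplus \bigoplus_{i \in I} A_i'$. *)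

(* Defs.v *)
From HB Require Import structures.
From mathcomp Require Import all_boot all_algebra.
From mathcomp Require Import boolp classical_sets functions cardinality fsbigop.

Set Implicit Arguments.
Unset Strict Implicit.
Unset Printing Implicit Defensive.

Import GRing.Theory.
Local Open Scope ring_scope.
Local Open Scope classical_set_scope.
Local Open Scope quotient_scope.

(* Right R-modules are left modules over the converse ring: in V : lmodType R^c
   the term r *: v stands for v r, and R^c^o is R_R since r *: x = x * r there.
   Submodules are terms of submodClosed V.  Their predicates are boolean and all
   carriers have a choice structure; with the axioms of boolp every subset of V
   is a boolean predicate and every type has a choice structure, so neither
   restricts the modules and submodules considered. *)
Notation rmodType R := (lmodType R^c).
Notation right_ideal R := (submodClosed R^c^o).

Section Submodule.
Variables (R : pzRingType) (V : lmodType R) (S : submodClosed V).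

Record submodule_type := Submodule {
  submodule_val :> V;
  _ : submodule_val \in S
}.

HB.instance Definition _ := [isSub for submodule_val].
HB.instance Definition _ := [Choice of submodule_type by <:].
HB.instance Definition _ := [SubChoice_isSubLmodule of submodule_type by <:].

End Submodule.

Section QuotientModule.
Variables (R : pzRingType) (V : lmodType R) (S : submodClosed V).

Definition submod_pred : V -> bool := fun x => x \in S.

Fact submod_pred_closed : zmod_closed submod_pred.
Proof. exact: GRing.submod_closedB (submodClosedP S). Qed.

Definition submod_zmodClosed : zmodClosed V := HB.pack_for (zmodClosed V)
  submod_pred (GRing.isZmodClosed.Build V submod_pred submod_pred_closed).

(* The additive group V / S of ring_quotient, with the induced scaling. *)
Definition quotient_module : Type := Quotient.quot submod_zmodClosed.

HB.instance Definition _ := GRing.Zmodule.on quotient_module.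
HB.instance Definition _ := EqQuotient.on quotient_module.

Definition quotient_scale (r : R) (x : quotient_module) : quotient_module :=
  \pi_quotient_module (r *: repr x).

Fact quotient_scale_pi r (v : V) :
  quotient_scale r (\pi_quotient_module v) = \pi_quotient_module (r *: v).
Proof.
apply/eqP; rewrite /quotient_scale -Quotient.idealrBE -scalerBr.
apply: (rpredZ (s := S)).
have := Quotient.idealrBE submod_zmodClosed (repr (\pi_quotient_module v)) v.
by rewrite reprK eqxx.
Qed.

Fact quotient_scaleA r s x :
  quotient_scale r (quotient_scale s x) = quotient_scale (r * s) x.
Proof.
rewrite -[x]reprK; move: (repr x) => v.
by rewrite (quotient_scale_pi s v) (quotient_scale_pi r) (quotient_scale_pi _ v) scalerA.
Qed.

Fact quotient_scale1 : left_id 1 quotient_scale.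
Proof. by move=> x; rewrite -[x]reprK quotient_scale_pi scale1r. Qed.

Fact quotient_scaleDr : right_distributive quotient_scale +%R.
Proof.
move=> r x y; rewrite -[x]reprK -[y]reprK; move: (repr x) (repr y) => v w.
by rewrite -raddfD !(quotient_scale_pi r) scalerDr raddfD.
Qed.

Fact quotient_scaleDl x : {morph quotient_scale^~ x : r s / r + s}.
Proof. by move=> r s; rewrite -[x]reprK !quotient_scale_pi scalerDl raddfD. Qed.

HB.instance Definition _ := GRing.Zmodule_isLmodule.Build R quotient_module
  quotient_scaleA quotient_scale1 quotient_scaleDr quotient_scaleDl.

End QuotientModule.

Definition module_iso (R : pzRingType) (U V : lmodType R) : Prop :=
  exists f : {linear U -> V}, bijective f.

(* Internal direct sum.  The finiteness clause is needed because the sum over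
   [set: I] is 0 by convention when f has infinite support. *)
Definition direct_sum (R : pzRingType) (V : lmodType R) (I : choiceType)
    (S : I -> submodClosed V) : Prop :=
  forall x : V, exists! f : I -> V,
    [/\ forall i, f i \in S i,
        finite_set [set i | f i != 0]
      & x = \sum_(i \in [set: I]) f i].

Definition direct_sum_seq (R : pzRingType) (V : lmodType R)
    (s : seq (submodClosed V)) : Prop :=
  direct_sum (fun i : 'I_(size s) => tnth (in_tuple s) i).

Definition exchange_property (R : pzRingType) (M : rmodType R) : Prop :=
  forall (A : rmodType R) (M' N : submodClosed A)
    (I : Type) (B : {classic I} -> submodClosed A),
    module_iso (submodule_type M') M ->
    direct_sum_seq [:: M'; N] ->
    direct_sum B ->
    exists B' : {classic I} -> submodClosed A,
      (forall i, {subset B' i <= B i}) /\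
      direct_sum (fun o : option {classic I} =>
                    if o is Some i then B' i else M').

Section RightIdeals.
Variables (R : pzRingType) (a : R).

Definition rann_pred : {pred R^c^o} := [pred x : R | a * x == 0].

Fact rann_closed : submod_closed rann_pred.
Proof.
split=> [|r x y]; rewrite !inE ?mulr0 // => /eqP ax0 /eqP ay0.
have -> : a * (r *: x + y) = a * x * r + a * y by rewrite -mulrA -mulrDr.
by rewrite ax0 ay0 mul0r addr0.
Qed.

HB.instance Definition _ := GRing.isSubmodClosed.Build R^c R^c^o rann_pred
  rann_closed.

Definition rann : right_ideal R := rann_pred.

Definition left_mul_ideal_pred (Y : right_ideal R) : {pred R^c^o} :=
  [pred z : R | `[< exists2 y : R, y \in Y & z = a * y >] ].

Fact left_mul_ideal_closed Y : submod_closed (left_mul_ideal_pred Y).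
Proof.
split=> [|r x y]; rewrite !inE.
  by exists 0; [exact: rpred0 | rewrite mulr0].
move=> [u uY ->] [v vY ->]; exists (u * r + v); last by rewrite mulrDr mulrA.
by apply: rpredD vY; apply: (rpredZ (s := Y) r).
Qed.

HB.instance Definition _ Y := GRing.isSubmodClosed.Build R^c R^c^o
  (left_mul_ideal_pred Y) (left_mul_ideal_closed Y).

Definition left_mul_ideal (Y : right_ideal R) : right_ideal R :=
  left_mul_ideal_pred Y.

Definition principal_right_ideal_pred : {pred R^c^o} :=
  [pred z : R | `[< exists r : R, z = a * r >] ].

Fact principal_right_ideal_closed : submod_closed principal_right_ideal_pred.
Proof.
split=> [|r x y]; rewrite !inE; first by exists 0; rewrite mulr0.
by move=> [u ->] [v ->]; exists (u * r + v); rewrite mulrDr mulrA.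
Qed.

HB.instance Definition _ := GRing.isSubmodClosed.Build R^c R^c^o
  principal_right_ideal_pred principal_right_ideal_closed.

Definition principal_right_ideal : right_ideal R := principal_right_ideal_pred.

Definition regular_element : Prop := exists x : R, a = a * x * a.

(* Units are spelled out: GRing.unit is not available over a pzRingType. *)
Definition unit_regular_element : Prop :=
  exists u v : R, [/\ u * v = 1, v * u = 1 & a = a * u * a].

End RightIdeals.

(* Main.v *)
(** Choose x with a = axa and let E0 = r(ax), a complement of aR, so that
    E0 is isomorphic to R/aR.  Starting from X = 0, Y = xaR, E = E0, the
    decompositions are built by induction on n, maintaining the extra equality
    E + X = E0 + aX.  Given R = K + X + Y = E + X + aY, exchange for K in R/X
    gives R = K + (X + E1) + Y1 with E1 inside E and Y1 inside aY.  Writing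
    E = E2 + E1, the invariant turns
    R = E0 + aR = E0 + aX + aE1 + aY1 into R = (E2 + aE1) + (X + E1) + aY1, and
    E2 + aE1 is isomorphic to E because a is injective on E1.  If a^n = 0 then
    Y = 0, so K and E are both isomorphic to R/X; an isomorphism of K with E0 is
    a left multiplication by some s with inverse t, and
    xax + t(1 - ax) is then a unit inner inverse of a. *)
Require Import Defs.
From HB Require Import structures.
From mathcomp Require Import all_boot all_algebra.
From mathcomp Require Import boolp classical_sets functions cardinality fsbigop.
Import GRing.Theory.
Local Open Scope ring_scope.

Set Implicit Arguments.
Unset Strict Implicit.
Unset Printing Implicit Defensive.

(** * Submodules and internal direct sums, elementwise *)

Section Submodules.
Variables (R : pzRingType) (V : lmodType R).
Implicit Types S T A B C : submodClosed V.

Lemma rpredZD S r x y : x \in S -> y \in S -> r *: x + y \in S.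
Proof. by move=> xS yS; apply: rpredD yS; apply: (rpredZ (s := S)). Qed.

Lemma submodB S x y : x \in S -> y \in S -> x - y \in S.
Proof. by move=> xS yS; rewrite addrC -scaleN1r; apply: rpredZD. Qed.

Lemma submodN S x : x \in S -> - x \in S.
Proof. by move=> xS; rewrite -sub0r; apply: submodB; rewrite ?rpred0. Qed.

(** Submodules carry boolean predicates; [asbool] supplies one for any linearly closed [P]. Sums,
    images and preimages below are obtained this way and used only through their membership
    equivalences. *)
Lemma submod_comprehension (P : V -> Prop) :
  P 0 -> (forall r x y, P x -> P y -> P (r *: x + y)) ->
  exists S, forall v, v \in S <-> P v.
Proof.
move=> P0 PL; pose p : {pred V} := fun v => `[< P v >].
have p_closed : submod_closed p.
  split=> [|r x y /asboolP Px /asboolP Py]; first exact/asboolP.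
  by apply/asboolP/PL.
pose S : submodClosed V := HB.pack_for (submodClosed V) p
  (GRing.isSubmodClosed.Build R V p p_closed).
by exists S => v; split=> /asboolP.
Qed.

Lemma submod_sum S T :
  exists U : submodClosed V,
    forall v, v \in U <-> exists s t, [/\ s \in S, t \in T & v = s + t].
Proof.
apply: submod_comprehension => [|r _ _ [s [t [sS tT ->]]] [s' [t' [sS' tT' ->]]]].
  by exists 0, 0; rewrite addr0; split; first exact: rpred0; first exact: rpred0.
exists (r *: s + s'), (r *: t + t').
by rewrite scalerDr addrACA; split; first exact: rpredZD; first exact: rpredZD.
Qed.

Definition direct_sum3 A B C : Prop :=
  (forall v, exists a b c, [/\ a \in A, b \in B, c \in C & v = a + b + c]) /\
  (forall a b c, a \in A -> b \in B -> c \in C -> a + b + c = 0 ->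
     [/\ a = 0, b = 0 & c = 0]).

(** A list [r] exhausting [I] makes every support finite and turns the sum over the full set into a
    list sum. Uniqueness of decompositions then reduces, by subtraction, to uniqueness for the zero
    vector. *)
Lemma direct_sum_finiteP (I : choiceType) (r : seq I) (S : I -> submodClosed V) :
  uniq r -> (forall i, i \in r) ->
  direct_sum S <->
  (forall v, exists2 f : I -> V,
     forall i, f i \in S i & v = \sum_(i <- r) f i) /\
  (forall f : I -> V, (forall i, f i \in S i) -> \sum_(i <- r) f i = 0 ->
     forall i, f i = 0).
Proof.
move=> r_uniq r_full.
have sumE (f : I -> V) : \sum_(i \in [set: I]%classic) f i = \sum_(i <- r) f i.
  by rewrite (fsbigE r) // => [|i _]; [apply: eq_bigl => i; rewrite in_setT
                                 | rewrite r_full].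
have fin (A : set I) : finite_set A.
  by apply: (@sub_finite_set _ _ [set` r]) => [i _|]; [exact: r_full|].
split=> [dS|[span indep] v]; last first.
  have [f fS vE] := span v; exists f; split; first by rewrite sumE.
  move=> g [gS _ vE']; apply/funext => i; apply/eqP; rewrite -subr_eq0; apply/eqP.
  apply: (indep (fun j => f j - g j)) => [j|]; first exact: submodB.
  by rewrite sumrB -vE -sumE -vE' subrr.
split=> [v|f fS f0 i]; first by have [f [[fS _ vE] _]] := dS v; exists f; rewrite -?sumE.
(* Both [f] and the zero family decompose 0, so both equal [g]. *)
have [g [_ g_uniq]] := dS 0.
have <- : g = f by apply: g_uniq; rewrite sumE f0.
suff -> : g = fun=> 0 by [].
apply: g_uniq; split=> [j||]; rewrite ?rpred0 //.
by rewrite sumE big1.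
Qed.

Lemma direct_sum_seq3P A B C :
  direct_sum_seq [:: A; B; C] <-> direct_sum3 A B C.
Proof.
rewrite /direct_sum_seq (direct_sum_finiteP (r := index_enum 'I_3)); last first.
- by move=> i; rewrite mem_index_enum.
- exact: index_enum_uniq.
have sum3 (f : 'I_3 -> V) : \sum_(i <- index_enum 'I_3) f i =
    f ord0 + f (lift ord0 ord0) + f ord_max.
  rewrite !big_ord_recl big_ord0 addr0 addrA; congr (_ + _ + f _).
  exact: val_inj.
pose tr (a b c : V) (i : 'I_3) := tnth [tuple a; b; c] i.
have trP a b c : a \in A -> b \in B -> c \in C ->
    forall i, tr a b c i \in tnth (in_tuple [:: A; B; C]) i.
  by move=> aA bB cC; case=> [[|[|[|]]]].
split=> [] [span indep]; split.
- move=> v; have [f fS vE] := span v.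
  exists (f ord0), (f (lift ord0 ord0)), (f ord_max).
  by rewrite -sum3; split; [exact: (fS ord0) | exact: (fS (lift ord0 ord0)) |
    exact: (fS ord_max) |].
- move=> a b c aA bB cC abc0.
  have tr0 := indep _ (trP _ _ _ aA bB cC); rewrite sum3 in tr0.
  by have {}tr0 := tr0 abc0; split; [exact: (tr0 ord0) |
    exact: (tr0 (lift ord0 ord0)) | exact: (tr0 ord_max)].
- move=> v; have [a [b [c [aA bB cC ->]]]] := span v.
  by exists (tr a b c); [exact: trP | rewrite sum3].
move=> f fS; rewrite sum3 => f0.
have [a0 b0 c0] := indep _ _ _ (fS ord0) (fS (lift ord0 ord0)) (fS ord_max) f0.
case=> [[|[|[|]]]] // i_lt; [rewrite -[RHS]a0 | rewrite -[RHS]b0 |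
  rewrite -[RHS]c0]; congr f; exact: val_inj.
Qed.

Lemma direct_sum_seq2 A B :
  (forall v, exists a b, [/\ a \in A, b \in B & v = a + b]) ->
  (forall a b, a \in A -> b \in B -> a + b = 0 -> a = 0 /\ b = 0) ->
  direct_sum_seq [:: A; B].
Proof.
move=> span indep.
rewrite /direct_sum_seq (direct_sum_finiteP (r := index_enum 'I_2)); last first.
- by move=> i; rewrite mem_index_enum.
- exact: index_enum_uniq.
have sum2 (f : 'I_2 -> V) : \sum_(i <- index_enum 'I_2) f i = f ord0 + f ord_max.
  rewrite !big_ord_recl big_ord0 addr0; congr (_ + f _); exact: val_inj.
split=> [v|f fS].
  have [a [b [aA bB ->]]] := span v; exists (fun i => tnth [tuple a; b] i).
    by case=> [[|[|]]].
  by rewrite sum2.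
rewrite sum2 => f0.
have [a0 b0] := indep _ _ (fS ord0) (fS ord_max) f0.
case=> [[|[|]]] // i_lt; [rewrite -[RHS]a0 | rewrite -[RHS]b0]; congr f; exact: val_inj.
Qed.

End Submodules.

(** * Isomorphisms given by their graphs *)

Section Isomorphisms.
Variable R : pzRingType.
Implicit Types U V W : lmodType R.

(* Working with graphs avoids choosing components along direct sums. *)
Lemma module_iso_of_rel U V (P : U -> V -> Prop) :
  (forall r u v u' v', P u v -> P u' v' -> P (r *: u + u') (r *: v + v')) ->
  (forall u, exists v, P u v) -> (forall v, exists u, P u v) ->
  (forall v, P 0 v -> v = 0) -> (forall u, P u 0 -> u = 0) ->
  module_iso U V.
Proof.
move=> PL totl totr P0l P0r.
have PB u v u' v' : P u v -> P u' v' -> P (u - u') (v - v').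
  by move=> Puv Puv'; rewrite -[u - _]addrC -[v - _]addrC -!scaleN1r; apply: PL.
have [f fP] := choice totl; have [g gP] := choice totr.
have f_fun u v : P u v -> f u = v.
  move=> Puv; apply/eqP; rewrite -subr_eq0; apply/eqP/P0l.
  by rewrite -(subrr u); apply: PB.
have g_fun u v : P u v -> g v = u.
  move=> Puv; apply/eqP; rewrite -subr_eq0; apply/eqP/P0r.
  by rewrite -(subrr v); apply: PB.
have f_lin : linear f by move=> r u u'; apply/f_fun/PL.
pose F : {linear U -> V} := HB.pack f (GRing.isLinear.Build R U V *:%R f f_lin).
by exists F; exists g => [u|v]; [apply/g_fun/fP | apply/f_fun/gP].
Qed.

(** The relation lives on the ambient modules, so it can be a condition such as congruence modulo a
    third submodule; its two kernels need to vanish only inside [S] and [T]. *)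
Lemma submodule_iso_of_rel V W (S : submodClosed V) (T : submodClosed W)
    (P : V -> W -> Prop) :
  (forall r u v u' v', P u v -> P u' v' -> P (r *: u + u') (r *: v + v')) ->
  (forall u, u \in S -> exists2 v, v \in T & P u v) ->
  (forall v, v \in T -> exists2 u, u \in S & P u v) ->
  (forall v, v \in T -> P 0 v -> v = 0) ->
  (forall u, u \in S -> P u 0 -> u = 0) ->
  module_iso (submodule_type S) (submodule_type T).
Proof.
move=> PL totl totr P0l P0r.
apply: (@module_iso_of_rel _ _ (fun u v => P (val u) (val v))).
- by move=> r u v u' v' /PL PLr /PLr; apply.
- move=> u; have [v vT Puv] := totl _ (valP u).
  by exists (Submodule vT).
- move=> v; have [u uS Puv] := totr _ (valP v).
  by exists (Submodule uS).
- by move=> v P0v; apply: val_inj; apply: P0l P0v; apply: valP.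
- by move=> u Pu0; apply: val_inj; apply: P0r Pu0; apply: valP.
Qed.

Lemma module_iso_trans U V W :
  module_iso U V -> module_iso V W -> module_iso U W.
Proof.
move=> [f f_bij] [g g_bij]; exists (g \o f : {linear U -> W}); exact: bij_comp.
Qed.

Lemma module_iso_sym U V : module_iso U V -> module_iso V U.
Proof.
move=> [f [g fK gK]]; exists (HB.pack g (GRing.isLinear.Build R V U *:%R g
  (can2_linear fK gK)) : {linear V -> U}); exact: (Bijective gK fK).
Qed.

End Isomorphisms.

(** * The canonical projection onto a quotient module *)

Section Quotient.
Local Open Scope quotient_scope.
Variables (R : pzRingType) (V : lmodType R) (S : submodClosed V).

(** A named form of the projection, to which a linear structure can be attached. *)
Definition quotient_pi (v : V) : quotient_module S := \pi_(quotient_module S) v.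

Fact quotient_pi_linear : linear quotient_pi.
Proof.
move=> r x y; rewrite /quotient_pi raddfD; congr (_ + _).
exact/esym/quotient_scale_pi.
Qed.

HB.instance Definition _ := GRing.isLinear.Build R V (quotient_module S) *:%R
  quotient_pi quotient_pi_linear.

Lemma quotient_pi_eq0 v : quotient_pi v = 0 <-> v \in S.
Proof.
rewrite -(raddf0 quotient_pi) /=.
have := Quotient.idealrBE (submod_zmodClosed S) v 0; rewrite subr0 => vE.
by split=> [/eqP|vS]; [rewrite -vE | apply/eqP; rewrite -vE].
Qed.

Lemma quotient_pi_surj x : exists v, quotient_pi v = x.
Proof. by exists (repr x); exact: reprK. Qed.

End Quotient.

(** * Images and preimages of submodules *)

Section LinearImages.
Variables (R : pzRingType) (V W : lmodType R) (f : {linear V -> W}).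

Lemma submod_image (S : submodClosed V) :
  exists T : submodClosed W,
    forall w, w \in T <-> exists2 v, v \in S & w = f v.
Proof.
apply: submod_comprehension => [|r _ _ [v vS ->] [v' vS' ->]].
  by exists 0; [exact: rpred0 | rewrite linear0].
by exists (r *: v + v'); [exact: rpredZD | rewrite linearP].
Qed.

Lemma submod_preimage (S : submodClosed V) (T : submodClosed W) :
  exists U : submodClosed V, forall v, v \in U <-> v \in S /\ f v \in T.
Proof.
apply: submod_comprehension => [|r v v' [vS fvT] [vS' fvT']].
  by rewrite linear0; split; exact: rpred0.
by rewrite linearP; split; apply: rpredZD.
Qed.

End LinearImages.

(** * Exchange modulo a submodule *)

(** Modulo X, the image of K is a copy of K because K meets X trivially, and V/X is both the direct
    sum of the images of K and Y and that of the images of E and Z. Exchange shrinks the latter two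
    images; pulling back to E and Z and restoring X gives the result. *)
Lemma exchange_mod (R : pzRingType) (V : rmodType R)
    (K X Y E Z : submodClosed V) :
  exchange_property (submodule_type K) ->
  direct_sum3 K X Y -> direct_sum3 E X Z ->
  exists E' Z' XE' : submodClosed V,
    [/\ {subset E' <= E}, {subset Z' <= Z},
        forall v, v \in XE' <->
          exists x e, [/\ x \in X, e \in E' & v = x + e]
      & direct_sum3 K XE' Z'].
Proof.
move=> exK [spanK indK] [spanE indE].
pose p : {linear V -> quotient_module X} := quotient_pi X.
have p_ker v : p v = 0 <-> v \in X := quotient_pi_eq0 X v.
have pX v : v \in X -> p v = 0 by move/p_ker.
have [pK pKP] := submod_image p K; have [pY pYP] := submod_image p Y.
have [pE pEP] := submod_image p E; have [pZ pZP] := submod_image p Z.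
have capKX k : k \in K -> k \in X -> k = 0.
  move=> kK kX; have [] // := indK k (- k) 0; rewrite ?addr0 ?subrr ?rpred0 //.
  exact: submodN.
have isoK : module_iso (submodule_type pK) (submodule_type K).
  apply: (@submodule_iso_of_rel _ _ _ _ _ (fun w k => w = p k)).
  - by move=> r w k w' k' -> ->; rewrite linearP.
  - by move=> w /pKP[k kK ->]; exists k.
  - by move=> k kK; exists (p k) => //; apply/pKP; exists k.
  - by move=> k kK /esym/p_ker; apply: capKX.
  - by move=> w _ ->; rewrite linear0.
have dsKY : direct_sum_seq [:: pK; pY].
  apply: direct_sum_seq2 => [w|_ _ /pKP[k kK ->] /pYP[y yY ->]].
    have [v <-] := quotient_pi_surj w; have [k [x [y [kK xX yY ->]]]] := spanK v.
    exists (p k), (p y); split; [by apply/pKP; exists k | by apply/pYP; exists y |].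
    by rewrite -[quotient_pi X _]/(p _) !linearD (pX x) // addr0.
  rewrite -linearD => /p_ker kyX.
  have [||k0 _ y0] := indK k (- (k + y)) y kK _ yY.
  - exact: submodN.
  - by rewrite addrAC subrr.
  by rewrite k0 y0 linear0.
(* Exchange is applied to a two-term family: [true] indexes the image of E, [false] that of Z. *)
pose B (b : {classic bool}) := if (b : bool) then pE else pZ.
have dsB : direct_sum B.
  apply/(@direct_sum_finiteP _ _ _ [:: (true : {classic bool}); false]).
  - by rewrite /= inE andbT; apply/eqP.
  - by case; rewrite !inE eqxx ?orbT.
  split=> [w|f fB].
    have [v <-] := quotient_pi_surj w; have [e [x [z [eE xX zZ ->]]]] := spanE v.
    exists (fun b : {classic bool} => if (b : bool) then p e else p z).
      by case; [apply/pEP; exists e | apply/pZP; exists z].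
    by rewrite !big_cons big_nil -[quotient_pi X _]/(p _) !linearD (pX x) // !addr0.
  rewrite !big_cons big_nil addr0.
  have /pEP[e eE fe] := fB true; have /pZP[z zZ fz] := fB false.
  rewrite fe fz -linearD => /p_ker ezX.
  have [||e0 _ z0] := indE e (- (e + z)) z eE _ zZ.
  - exact: submodN.
  - by rewrite addrAC subrr.
  by case; rewrite ?fe ?fz ?e0 ?z0 linear0.
have [B' [B'B dsB']] := exK _ pK pY bool B isoK dsKY dsB.
(* The preimages are cut down to E and Z, where p is injective, rather than taken in all of V, where
   they would contain X. *)
have [E' E'P] := submod_preimage p E (B' true).
have [Z' Z'P] := submod_preimage p Z (B' false).
have [XE' XE'P] := submod_sum X E'.
exists E', Z', XE'; split=> //; try by move=> v /E'P[]. 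
  by move=> v /Z'P[].
move/(@direct_sum_finiteP _ _ _ [:: None; Some (true : {classic bool});
  Some (false : {classic bool})]): dsB' => [||spanB indB].
- by rewrite /= !inE !andbT; apply/eqP => -[].
- by case=> [[]|]; rewrite !inE eqxx ?orbT.
split=> [v|k xe z kK /XE'P[x [e [xX /E'P[eE eB] ->]]] /Z'P[zZ zB] sum0].
  have [f fB fv] := spanB (p v).
  have /pKP[k kK fk] := fB None.
  have fe := fB (Some true); have fz := fB (Some false).
  have /pEP[e eE fe'] := B'B _ _ fe; have /pZP[z zZ fz'] := B'B _ _ fz.
  (* Lifting a decomposition of [p v] leaves an error in X, which the summand X + E' absorbs. *)
  have vX : v - (k + e + z) \in X.
    apply/p_ker; rewrite linearB fv !big_cons big_nil addr0 fk fe' fz' addrA.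
    by rewrite -!(linearD p) subrr.
  exists k, (v - (k + e + z) + e), z; split=> //.
  - apply/XE'P; exists (v - (k + e + z)), e; split=> //; apply/E'P.
    by split; rewrite // -fe'.
  - by apply/Z'P; split; rewrite // -fz'.
  - by rewrite addrCA -[RHS]addrA -[RHS]addrA addrA subrK.
(* Applying p to the relation kills [x]; directness in V/X then puts [k], [e] and [z] in X, which
   meets each of K, E and Z trivially. *)
pose f (o : option {classic bool}) :=
  if o is Some b then if (b : bool) then p e else p z else p k.
have /(_ _) f0 : forall o, f o = 0.
  apply: indB => [[[]|]|] //; first by apply/pKP; exists k.
  rewrite !big_cons big_nil /= addr0 -[RHS](linear0 p) -sum0 !linearD (pX x) //.
  by rewrite add0r addrA.
have k0 : k = 0 by apply: capKX => //; apply/p_ker/(f0 None).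
have eX : e \in X by apply/p_ker/(f0 (Some true)).
have zX : z \in X by apply/p_ker/(f0 (Some false)).
have [||e0 _ _] := indE e (- e) 0 eE _ (rpred0 _); rewrite ?addr0 ?subrr //.
  exact: submodN.
have [||_ _ z0] := indE 0 (- z) z (rpred0 _) _ zZ; rewrite ?add0r ?addNr //.
  exact: submodN.
by move: sum0; rewrite k0 e0 z0 add0r !addr0.
Qed.

(** * The induction step, for an endomorphism f with kernel K *)

Section EndomorphismDecompositions.
Variables (R : pzRingType) (V : rmodType R) (f : {linear V -> V}).
Variables (K E0 : submodClosed V).
Hypothesis kerf : forall v, v \in K <-> f v = 0.
Hypothesis exK : exchange_property (submodule_type K).
Hypothesis indE0 : forall e v, e \in E0 -> e + f v = 0 -> e = 0.
Implicit Types X Y E fY : submodClosed V.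

Definition is_image Y fY : Prop :=
  forall w, w \in fY <-> exists2 v, v \in Y & w = f v.

(** This is the equality E + X = E0 + f(X). It trades sums in E + X for sums whose E0 part is
    independent of the image of f. *)
Definition balanced X E : Prop :=
  forall v, (exists e x, [/\ e \in E, x \in X & v = e + x]) <->
    (exists e x, [/\ e \in E0, x \in X & v = e + f x]).

(** Since f kills K and is injective on the complement X + E1 + Y1, its image is f(X) + f(E1) +
    f(Y1), a direct sum. Adding E0 and using the balance gives V = E + X + f(E1) + f(Y1), still
    direct; moving E1 from E over to X yields the new summands. The image of Y' enters through any
    submodule with the right membership, so that [left_mul_ideal] can be used later. *)
Lemma decomposition_step X Y E fY :
  is_image Y fY -> direct_sum3 K X Y -> direct_sum3 E X fY -> balanced X E ->
  exists X' Y' E' : submodClosed V,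
    [/\ direct_sum3 K X' Y', {subset Y' <= fY},
        forall fY', is_image Y' fY' -> direct_sum3 E' X' fY',
        module_iso (submodule_type E) (submodule_type E')
      & balanced X' E'].
Proof.
move=> fYP dsK dsE bal.
have [E1 [Y1 [X1 [E1E Y1Y X1P [spanK indK]]]]] := exchange_mod exK dsK dsE.
have [spanE indE] := dsE.
have indEX (e x : V) : e \in E -> x \in X -> e + x = 0 -> e = 0 /\ x = 0.
  move=> eE xX ex0; have [] // := indE e x 0 eE xX (rpred0 _).
  by rewrite addr0.
have X1I (x e : V) : x \in X -> e \in E1 -> x + e \in X1.
  by move=> xX eE1; apply/X1P; exists x, e.
(* E2 is the intersection of E with K + X + Y1; by the modular law it is a complement of E1 in E. *)
have [E2 E2P] : exists E2 : submodClosed V, forall v, v \in E2 <->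
    v \in E /\ exists k x y, [/\ k \in K, x \in X, y \in Y1 & v = k + x + y].
  apply: submod_comprehension.
    split; first exact: rpred0.
    by exists 0, 0, 0; split; try exact: rpred0; rewrite !addr0.
  move=> r v v' [vE [k [x [y [kK xX yY v_eq]]]]] [vE' [k' [x' [y' [kK' xX' yY' v'_eq]]]]].
  split; first exact: rpredZD.
  exists (r *: k + k'), (r *: x + x'), (r *: y + y').
  split; try exact: rpredZD.
  by rewrite v_eq v'_eq !scalerDr (AC (3*3) ((1*4)*(2*5)*(3*6))).
have E2E e : e \in E2 -> e \in E by case/E2P.
have E_split (e : V) : e \in E -> exists e2 e1,
    [/\ e2 \in E2, e1 \in E1 & e = e2 + e1].
  move=> eE; have [k [_ [y [kK /X1P[x [e1 [xX e1E ->]]] yY eq_e]]]] := spanK e.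
  exists (e - e1), e1; split; rewrite ?subrK //; apply/E2P; split.
    by apply: submodB => //; exact: E1E.
  by exists k, x, y; split; rewrite // eq_e (AC ((1*2*1)*1) ((1*2*4)*(3*5))) /= subrr addr0.
(* f is injective on the direct sum X + E1 + Y1, a complement of its kernel. *)
have ind_aK (x e y : V) : x \in X -> e \in E1 -> y \in Y1 ->
    f (x + e + y) = 0 -> [/\ x = 0, e = 0 & y = 0].
  move=> xX eE1 yY /kerf xeyK.
  have [|_ xe0 y0] := indK (- (x + e + y)) (x + e) y (submodN xeyK) (X1I _ _ xX eE1) yY.
    by rewrite -addrA addNr.
  by have [|e0 x0] := indEX e x (E1E _ eE1) xX; first by rewrite addrC.
have indE21 (e2 e1 : V) : e2 \in E2 -> e1 \in E1 -> e2 + e1 = 0 -> e2 = 0 /\ e1 = 0.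
  move=> /E2P[_ [k [x [y [kK xX yY ->]]]]] e1E sum0.
  have [|k0 xe0 y0] := indK k (x + e1) y kK (X1I _ _ xX e1E) yY.
    by rewrite -sum0 (AC (1*2*1) (1*2*4*3)).
  have [|e0 x0] := indEX e1 x (E1E _ e1E) xX; first by rewrite addrC.
  by rewrite k0 x0 y0 !addr0.
have [aE1 aE1P] : exists aE1 : submodClosed V,
    forall v, v \in aE1 <-> exists2 e, e \in E1 & v = f e.
  exact: submod_image.
have [E' E'P] := submod_sum E2 aE1.
have E'I (e2 e1 : V) : e2 \in E2 -> e1 \in E1 -> e2 + f e1 \in E'.
  by move=> e2E e1E; apply/E'P; exists e2, (f e1); split=> //; apply/aE1P; exists e1.
have E'_split (v : V) : v \in E' -> exists e2 e1,
    [/\ e2 \in E2, e1 \in E1 & v = e2 + f e1].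
  by case/E'P=> e2 [_ [e2E /aE1P[e1 e1E ->] ->]]; exists e2, e1.
(* The sum E + X + f(E1) + f(Y1) is direct: rewrite [e + x] as [g + f z], kill [g] by [indE0], then
   apply injectivity of f. *)
have ind_all (e x e1 y : V) : e \in E -> x \in X -> e1 \in E1 -> y \in Y1 ->
    e + x + f e1 + f y = 0 -> [/\ e = 0, x = 0, e1 = 0 & y = 0].
  move=> eE xX e1E yY.
  have [|g [z [gE zX exE]]] := (bal (e + x)).1; first by exists e, x.
  rewrite exE -!addrA -!(linearD f) addrA => sum0.
  have g0 := indE0 gE sum0; rewrite g0 add0r in sum0.
  have [z0 e10 y0] := ind_aK _ _ _ zX e1E yY sum0.
  by have [] := indEX e x eE xX; rewrite // exE g0 z0 (linear0 f) addr0.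
exists X1, Y1, E'; split=> //.
- move=> fY' fY'P; split=> [v|_ _ _ /E'_split[e2 [e1 [e2E e1E ->]]] /X1P[x [e [xX eE1 ->]]]
          /fY'P[y yY ->] sum0].
    (* First v is written as [g + f (z + y)] with [g] in E0. Then [z + y] is decomposed along K + (X
       + E1) + Y1, f drops the K component, and the balance returns [g + f x1] to E + X. *)
    have [e [x [_ [eE xX /fYP[y yY ->] ->]]]] := spanE v.
    have [|g [z [gE zX ->]]] := (bal (e + x)).1; first by exists e, x.
    have [k [_ [y1 [kK /X1P[x1 [e1 [x1X e1E ->]]] y1Y zyE]]]] := spanK (z + y).
    have [|e' [x' [eE' xX' gx1E]]] := (bal (g + f x1)).2; first by exists g, x1.
    have [e2 [e1' [e2E e1E' e'E]]] := E_split _ eE'.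
    exists (e2 + f e1), (x' + e1'), (f y1); split; [exact: E'I|exact: X1I| |].
      by apply/fY'P; exists y1.
    rewrite -[LHS]addrA -(linearD f) zyE !(linearD f) (kerf k).1 // add0r.
    rewrite !addrA gx1E e'E; congr (_ + _).
    by rewrite (ACl (1*4*3*2)).
  have eE := rpredD (E2E _ e2E) (E1E _ eE1).
  have [|e0 x0 e10 y0] := ind_all _ _ _ _ eE xX e1E yY.
    by rewrite -sum0; congr (_ + _); rewrite (AC (3*1) ((1*4)*(3*2))).
  have [e20 e0'] := indE21 _ _ e2E eE1 e0.
  by rewrite e20 x0 e10 y0 e0' !(linear0 f) addr0.
(* The isomorphism is the identity on E2 and f on E1. *)
- apply: (@submodule_iso_of_rel _ _ _ _ _ (fun u v : V => exists e2 e1,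
    [/\ e2 \in E2, e1 \in E1, u = e2 + e1 & v = e2 + f e1])).
  + move=> r _ _ _ _ [e2 [e1 [e2E e1E -> ->]]] [f2 [f1 [f2E f1E -> ->]]].
    exists (r *: e2 + f2), (r *: e1 + f1); split; try exact: rpredZD.
      by rewrite scalerDr addrACA.
    by rewrite (linearP f) scalerDr addrACA.
  + move=> e /E_split[e2 [e1 [e2E e1E ->]]].
    by exists (e2 + f e1); [exact: E'I | exists e2, e1].
  + move=> v /E'_split[e2 [e1 [e2E e1E ->]]].
    by exists (e2 + e1); [exact: rpredD (E2E _ _) (E1E _ _) | exists e2, e1].
  + move=> v _ [e2 [e1 [e2E e1E /esym/(indE21 _ _ e2E e1E)[-> ->] ->]]].
    by rewrite (linear0 f) addr0.
  + move=> u _ [e2 [e1 [e2E e1E -> /esym sum0]]].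
    have [|-> _ -> _] := ind_all e2 0 e1 0 (E2E _ e2E) (rpred0 _) e1E (rpred0 _).
      by rewrite (linear0 f) !addr0.
    by rewrite addr0.
(* The new balance: E' + X' = E + X + f(E1) = E0 + f(X) + f(E1) = E0 + f(X'). *)
- move=> v; split.
    move=> [_ [_ [/E'_split[e2 [e1 [e2E e1E ->]]] /X1P[x [e [xX eE1 ->]]] ->]]].
    have [|g [z [gE zX exE]]] := (bal (e2 + e + x)).1.
      by exists (e2 + e), x; split=> //; exact: rpredD (E2E _ _) (E1E _ _).
    exists g, (z + e1); split=> //; first exact: X1I.
    by rewrite (linearD f) [RHS]addrA -exE (AC (2*2) ((1*4*3)*2)).
  move=> [g [_ [gE /X1P[z [e1 [zX e1E ->]]] ->]]].
  have [|e [x [eE xX gzE]]] := (bal (g + f z)).2; first by exists g, z.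
  have [e2 [e1' [e2E e1E' eE2]]] := E_split _ eE.
  exists (e2 + f e1), (x + e1'); split; [exact: E'I | exact: X1I |].
  by rewrite (linearD f) addrA gzE eE2 (AC (3*1) ((1*4)*(3*2))).
Qed.

End EndomorphismDecompositions.

(** * Regular elements, unit-regularity and the induction *)

Section RegularElements.
Variables (R : pzRingType) (a x : R).
Hypothesis axa : a = a * x * a.

Lemma rannP (b : R) (v : R^c^o) : v \in rann b <-> b * (v : R) = 0.
Proof. by split=> /eqP. Qed.

Definition left_mul (b : R) (v : R^c^o) : R^c^o := b * (v : R).

Fact left_mul_linear b : linear (left_mul b).
Proof. by move=> r u v; rewrite /left_mul mulrDr; congr (_ + _); exact: (mulrA b u r). Qed.

HB.instance Definition _ b := GRing.isLinear.Build R^c R^c^o R^c^o *:%R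
  (left_mul b) (left_mul_linear b).

Lemma left_mul_ideal_image (b : R) (Y : right_ideal R) :
  is_image (left_mul b) Y (left_mul_ideal b Y).
Proof. by move=> w; split=> /asboolP. Qed.

Lemma principal_right_idealP (b : R) (v : R^c^o) :
  v \in principal_right_ideal b <-> exists r : R, v = b * r.
Proof. by split=> /asboolP. Qed.

(** Left multiplication by ax fixes aR and kills its annihilator r(ax), so the two meet
    trivially. *)
Lemma rann_mulr_inner_ind (e v : R) :
  e \in rann (a * x) -> e + a * v = 0 -> e = 0.
Proof.
move=> /rannP axe0 sum0; have av0 : a * v = 0.
  by rewrite axa -mulrA -[LHS]add0r -axe0 -mulrDr sum0 mulr0.
by rewrite av0 addr0 in sum0.
Qed.

(** The projection onto R/aR restricts to a bijection on r(ax): the class of v is represented there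
    by v - axv. *)
Lemma rann_mulr_inner_iso :
  module_iso (submodule_type (rann (a * x)))
    (quotient_module (principal_right_ideal a)).
Proof.
set S := principal_right_ideal a.
apply: (@module_iso_of_rel _ _ _ (fun u w => w = quotient_pi S (val u))).
- by move=> r u _ u' _ -> ->; rewrite linearP.
- by move=> u; exists (quotient_pi S (val u)).
- move=> w; have [v <-] := quotient_pi_surj w.
  have vE : (v : R) - a * x * v \in rann (a * x).
    by apply/rannP; rewrite mulrBr !mulrA -axa subrr.
  exists (Submodule vE); apply/eqP; rewrite -subr_eq0 -linearB; apply/eqP.
  apply/quotient_pi_eq0/principal_right_idealP; exists (x * v).
  by rewrite mulrA /= opprB addrC subrK.
- by move=> w ->; rewrite linear0.
move=> u /esym/quotient_pi_eq0/principal_right_idealP[r u_eq].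
apply: val_inj; apply: (@rann_mulr_inner_ind _ (- r)); first exact: valP.
by rewrite mulrN -u_eq subrr.
Qed.

(** The annihilators r(a) and r(ax) are generated by the idempotents 1 - xa and 1 - ax, so an
    isomorphism between them is left multiplication by the image s of 1 - xa, and its inverse by the
    image t of 1 - ax. *)
Lemma unit_regular_of_iso :
  module_iso (submodule_type (rann a)) (submodule_type (rann (a * x))) ->
  unit_regular_element a.
Proof.
move=> [phi [psi phiK psiK]].
have kP : (1 - x * a : R) \in rann a.
  by apply/rannP; rewrite mulrBr mulr1 mulrA -axa subrr.
have eP : (1 - a * x : R) \in rann (a * x).
  by apply/rannP; rewrite mulrBr mulr1 mulrA -axa subrr.
pose k := Submodule kP; pose e := Submodule eP.
have psiZ r u : psi (r *: u) = r *: psi u.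
  by rewrite -[RHS]phiK linearZ /= psiK.
pose s : R := val (phi k); pose t : R := val (psi e).
have sE : a * x * s = 0 by apply/rannP/(valP (phi k)).
have tK : a * t = 0 by apply/rannP/(valP (psi e)).
(* As scaling is right multiplication, [s *: e] is (1 - ax)s = s, the image of [k]; the inverse map
   sends it both to [k] and to ts. *)
have ts : t * s = 1 - x * a.
  have : psi ((s : R^c) *: e) = k.
    rewrite -[RHS]phiK; congr psi; apply: val_inj.
    change ((1 - a * x) * s = s); by rewrite mulrBl mul1r sE subr0.
  by rewrite psiZ => /(congr1 val).
have st : s * t = 1 - a * x.
  have : phi ((t : R^c) *: k) = e.
    rewrite -[RHS]psiK; congr (phi _); apply: val_inj.
    change ((1 - x * a) * t = t); by rewrite mulrBl mul1r -mulrA tK mulr0 subr0.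
  by rewrite linearZ => /(congr1 val).
(* Relative to R = xaR + r(a) and R = aR + r(ax), the second element acts as a on the first summand
   and s on the second; the first element inverts it blockwise by xax and t. Mixed products
   vanish. *)
exists (x * a * x + t * (1 - a * x)), (a + s * (1 - x * a)).
have ea0 : (1 - a * x) * a = 0 by rewrite mulrBl mul1r -axa subrr.
have ka0 : a * (1 - x * a) = 0 by exact/rannP.
have es : (1 - a * x) * s = s by rewrite mulrBl mul1r sE subr0.
have kt : (1 - x * a) * t = t by rewrite mulrBl mul1r -mulrA tK mulr0 subr0.
have kk : (1 - x * a) * (1 - x * a) = 1 - x * a.
  by rewrite {1}mulrBl mul1r -mulrA ka0 mulr0 subr0.
have ee : (1 - a * x) * (1 - a * x) = 1 - a * x.
  by rewrite mulrBr mulr1 mulrA ea0 mul0r subr0.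
have xaxa : x * a * x * a = x * a by rewrite -!mulrA (mulrA a x a) -axa.
split.
- rewrite mulrDl [X in X + _]mulrDr [X in _ + X]mulrDr xaxa.
  have -> : x * a * x * (s * (1 - x * a)) = 0.
    by rewrite mulrA -(mulrA x a x) -(mulrA x _ s) sE mulr0 mul0r.
  have -> : t * (1 - a * x) * a = 0 by rewrite -mulrA ea0 mulr0.
  have -> : t * (1 - a * x) * (s * (1 - x * a)) = 1 - x * a.
    by rewrite mulrA -(mulrA t) es ts kk.
  by rewrite addr0 add0r addrC subrK.
- rewrite mulrDl [X in X + _]mulrDr [X in _ + X]mulrDr.
  have -> : a * (x * a * x) = a * x by rewrite !mulrA -axa.
  have -> : a * (t * (1 - a * x)) = 0 by rewrite mulrA tK mul0r.
  have -> : s * (1 - x * a) * (x * a * x) = 0.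
    by rewrite -mulrA mulrBl mul1r !mulrA xaxa subrr mulr0.
  have -> : s * (1 - x * a) * (t * (1 - a * x)) = 1 - a * x.
    by rewrite mulrA -(mulrA s) kt st ee.
  by rewrite addr0 add0r addrC subrK.
by rewrite mulrDr (mulrA a t) tK mul0r addr0 !mulrA -!axa.
Qed.

(** Starting at n = 0 makes the containment of Y in a^0 R = R vacuous. The balance is kept for the
    next step, and E is compared with r(ax), the module E0 of the induction. *)
Lemma decompositions n :
  exchange_property (submodule_type (rann a)) ->
  exists X Y E : right_ideal R,
    [/\ direct_sum3 (rann a) X Y, direct_sum3 E X (left_mul_ideal a Y),
        {subset Y <= principal_right_ideal (a ^+ n)},
        module_iso (submodule_type (rann (a * x))) (submodule_type E)
      & balanced (left_mul a) (rann (a * x)) X E].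
Proof.
move=> exK; elim: n => [|n [X [Y [E [dsK dsE Yn isoE bal]]]]]; last first.
  have kerf v : v \in rann a <-> left_mul a v = 0 := rannP a v.
  have [X' [Y' [E' [dsK' Y'Y dsE' isoE' bal']]]] := decomposition_step kerf exK
    rann_mulr_inner_ind (left_mul_ideal_image a Y) dsK dsE bal.
  exists X', Y', E'; split=> //; first exact/dsE'/left_mul_ideal_image.
    (* Y' lies in aY, hence in a(a^n R). *)
    move=> v /Y'Y/left_mul_ideal_image[y /Yn/principal_right_idealP[r ->] ->].
    by apply/principal_right_idealP; exists r; rewrite exprS -mulrA.
  exact: module_iso_trans isoE isoE'.
have [O OP] : exists O : right_ideal R, forall v : R^c^o, v \in O <-> v = 0.
  apply: submod_comprehension => // r _ _ -> ->; by rewrite scaler0 addr0.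
have O0 : (0 : R^c^o) \in O by exact/OP.
(* With X = 0 these are the splittings of R by the idempotents xa and ax, since a(xaR) = aR. *)
exists O, (principal_right_ideal (x * a)), (rann (a * x)); split.
- split=> [v|k o _ /rannP kK /OP -> /principal_right_idealP[r ->]].
    exists ((v : R) - x * a * v), 0, (x * a * v : R); split=> //.
    + by apply/rannP; rewrite mulrBr !mulrA -axa subrr.
    + by apply/principal_right_idealP; exists v.
    + by rewrite addr0 subrK.
  rewrite addr0 => sum0.
  have ar0 : a * r = 0.
    by rewrite axa -!mulrA (mulrA x) -[LHS]add0r -kK -mulrDr sum0 mulr0.
  by move: sum0; rewrite -mulrA ar0 mulr0 addr0.
- split=> [v|e o _ eE /OP -> /left_mul_ideal_image[_ /principal_right_idealP[r ->] ->]].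
    exists ((v : R) - a * x * v), 0, (a * x * v : R); split=> //.
    + by apply/rannP; rewrite mulrBr !mulrA -axa subrr.
    + apply/left_mul_ideal_image; exists (x * a * (x * v)).
        by apply/principal_right_idealP; exists (x * v).
      by change (a * x * v = a * (x * a * (x * v)) :> R); rewrite !mulrA -axa.
    + by rewrite addr0 subrK.
  rewrite addr0 => sum0; have e0 := rann_mulr_inner_ind eE sum0.
  by rewrite e0 add0r in sum0.
- by move=> v _; apply/principal_right_idealP; exists v; rewrite mul1r.
- by exists idfun; exists idfun.
by move=> v; split=> -[e [o [eE /OP -> ->]]]; exists e, 0; rewrite linear0.
Qed.

End RegularElements.

Theorem theorem2 (R : pzRingType) (a : R)
    (regular_a : regular_element a)
    (exchange_K : exchange_property (submodule_type (rann a))) :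
  forall n : nat, (0 < n)%N ->
  exists X Y E : right_ideal R,
    [/\ direct_sum_seq [:: rann a; X; Y],
        direct_sum_seq [:: E; X; left_mul_ideal a Y],
        {subset Y <= principal_right_ideal (a ^+ n)},
        module_iso (submodule_type E)
          (quotient_module (principal_right_ideal a))
      & a ^+ n = 0 ->
        [/\ left_mul_ideal a Y =i pred1 (0 : R),
            Y =i pred1 (0 : R),
            module_iso (submodule_type (rann a)) (submodule_type E),
            module_iso (submodule_type E)
              (quotient_module (principal_right_ideal a))
          & unit_regular_element a]].
Proof.
move=> n _; have [x axa] := regular_a.
have [X [Y [E [dsK dsE Yn isoE _]]]] := decompositions axa n exchange_K.
have isoEq := module_iso_trans (module_iso_sym isoE) (rann_mulr_inner_iso axa).
exists X, Y, E; split=> //; try exact/direct_sum_seq3P.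
move=> an0.
have Y0 (y : R) : y \in Y -> y = 0.
  by move=> /Yn/principal_right_idealP[r ->]; rewrite an0 mul0r.
have aY0 (y : R) : y \in left_mul_ideal a Y -> y = 0.
  by move=> /left_mul_ideal_image[z /Y0 -> ->]; rewrite linear0.
have [spanK indK] := dsK; have [spanE indE] := dsE.
(* K and E are now two complements of X, and congruence modulo X is the graph of an isomorphism
   between them. *)
have isoK : module_iso (submodule_type (rann a)) (submodule_type E).
  apply: (@submodule_iso_of_rel _ _ _ _ _ (fun k e => k - e \in X)).
  - move=> r k e k' e' ke ke'.
    by rewrite opprD addrACA -scalerBr; exact: rpredZD.
  - move=> k kK; have [e [z [y [eE zX /aY0 -> k_eq]]]] := spanE k.
    by exists e => //; rewrite k_eq addr0 addrC addKr.
  - move=> e eE; have [k [z [y [kK zX /Y0 -> e_eq]]]] := spanK e.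
    exists k => //; rewrite e_eq addr0 opprD addrA subrr add0r.
    exact: submodN.
  - move=> e eE; rewrite sub0r => eX.
    by have [|->] := indE e (- e) 0 eE eX (rpred0 _); rewrite ?addr0 ?subrr.
  - move=> k kK; rewrite subr0 => kX.
    by have [|->] := indK k (- k) 0 kK (submodN kX) (rpred0 _); rewrite ?addr0 ?subrr.
have zeroP (S : right_ideal R) : (forall y : R, y \in S -> y = 0) -> S =i pred1 (0 : R).
  move=> S0 y; rewrite [RHS]inE; apply/idP/eqP => [/S0 //|->]; exact: rpred0.
split=> //; [exact: zeroP aY0 | exact: zeroP Y0 |].
exact: unit_regular_of_iso axa (module_iso_trans isoK (module_iso_sym isoE)).
Qed.
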